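(* Let $\mathcal{X}\subseteq\mathbb{R}^m$ and $\mathcal{Y}\subseteq\mathbb{R}^n$ be nonempty polytopes and $A\in\mathbb{R}^{m\times n}$. Let $\alpha>0$ be a constant, depending only on $(A,\mathcal{X},\mathcal{Y})$, such that $\max_{y\in\mathcal{Y}}x^\top Ay-v^\ast\ge\alpha\cdot\mathrm{dist}(x,\mathcal{X}^\ast)$ for all $x\in\mathcal{X}$. If $\mu\in\left(0,\frac{\alpha}{\max_{x\in\mathcal{X}}\|x\|}\right)$, then the (unique) minimax strategy $x^\mu$ of the asymmetrically perturbed game $\min_{x\in\mathcal{X}}\max_{y\in\mathcal{Y}}\{x^\top Ay+\frac{\mu}{2}\|x\|^2\}$ satisfies $x^\mu\in\mathcal{X}^\ast$.
   Context: A polytope is a bounded polyhedron (compact). $\|\cdot\|$ is the Euclidean norm, and $\mathrm{dist}(a,S)=\min_{s\in S}\|a-s\|$ for a closed convex set $S$. The game value is $v^\ast=\min_{x\in\mathcal{X}}\max_{y\in\mathcal{Y}}x^\top Ay=\max_{y\in\mathcal{Y}}\min_{x\in\mathcal{X}}x^\top Ay$. The set of minimax strategies of the original game is $\mathcal{X}^\ast=\operatorname{argmin}_{x\in\mathcal{X}}\max_{y\in\mathcal{Y}}x^\top Ay$. The minimax strategy of the perturbed game is $x^\mu=\operatorname{argmin}_{x\in\mathcal{X}}\max_{y\in\mathcal{Y}}\{x^\top Ay+\frac{\mu}{2}\|x\|^2\}$. A constant $\alpha>0$ with the stated growth property is known to exist for every such game. *)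

(* Defs.v *)
From HB Require Import structures.
From mathcomp Require Import all_boot all_order all_algebra.
From mathcomp Require Import boolp classical_sets reals ereal.

Set Implicit Arguments.
Unset Strict Implicit.
Unset Printing Implicit Defensive.

Import Order.TTheory GRing.Theory Num.Theory.

Local Open Scope classical_set_scope.
Local Open Scope ring_scope.

(* MathComp-Analysis norms a matrix by the maximum of its entries, so the     *)
(* Euclidean norm is defined here.                                            *)
Definition enorm (R : realType) (k : nat) (x : 'cV[R]_k) : R :=
  Num.sqrt (\sum_(i < k) x i 0 ^+ 2).

Definition polyhedron (R : realType) (k : nat) (P : set 'cV[R]_k) : Prop :=
  exists (p : nat) (C : 'M[R]_(p, k)) (b : 'cV[R]_p),
    P = [set x | forall i : 'I_p, (C *m x) i 0 <= b i 0].

Definition polytope (R : realType) (k : nat) (P : set 'cV[R]_k) : Prop :=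
  polyhedron P /\ exists M : R, forall x, P x -> enorm x <= M.

(* Maxima and minima of real values are written with [sup] and [inf]. They    *)
(* are attained whenever they are taken over a nonempty polytope of a         *)
(* continuous function, which is how they are used below.                     *)

Definition dist (R : realType) (k : nat) (a : 'cV[R]_k) (S : set 'cV[R]_k) : R :=
  inf [set enorm (a - s) | s in S].

Definition max_enorm (R : realType) (k : nat) (S : set 'cV[R]_k) : R :=
  sup [set enorm x | x in S].

Definition argmin (R : realType) (T : Type) (S : set T) (f : T -> R) : set T :=
  [set x | S x /\ forall z, S z -> f x <= f z].

Definition payoff (R : realType) (m n : nat) (A : 'M[R]_(m, n))
    (x : 'cV[R]_m) (y : 'cV[R]_n) : R :=
  (x^T *m A *m y) 0 0.

Definition perturbed_payoff (R : realType) (m n : nat) (A : 'M[R]_(m, n))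
    (mu : R) (x : 'cV[R]_m) (y : 'cV[R]_n) : R :=
  payoff A x y + mu / 2 * enorm x ^+ 2.

(* Worst case, over the opponent's strategies, of the strategy [x] in the     *)
(* game with payoff function [u].                                             *)
Definition worst_case (R : realType) (m n : nat) (Y : set 'cV[R]_n)
    (u : 'cV[R]_m -> 'cV[R]_n -> R) (x : 'cV[R]_m) : R :=
  sup [set u x y | y in Y].

Definition game_value (R : realType) (m n : nat) (X : set 'cV[R]_m)
    (Y : set 'cV[R]_n) (u : 'cV[R]_m -> 'cV[R]_n -> R) : R :=
  inf [set worst_case Y u x | x in X].

Definition minimax_strategies (R : realType) (m n : nat) (X : set 'cV[R]_m)
    (Y : set 'cV[R]_n) (u : 'cV[R]_m -> 'cV[R]_n -> R) : set 'cV[R]_m :=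
  argmin X (worst_case Y u).

(* Main.v *)
Require Import Defs.
From HB Require Import structures.
From mathcomp Require Import all_boot all_order all_algebra.
From mathcomp Require Import boolp classical_sets reals ereal.
From mathcomp Require Import topology normedtype derive realfun.
From mathcomp Require Import ring lra.

Set Implicit Arguments.
Unset Strict Implicit.
Unset Printing Implicit Defensive.

Import Order.TTheory GRing.Theory Num.Theory.
Import numFieldNormedType.Exports.

Local Open Scope classical_set_scope.
Local Open Scope ring_scope.

(** Write [f x] for the worst case of [x] in the original game, [v] for its
    value, [S] for its set of minimax strategies, and [M] for the largest
    Euclidean norm on [X]. The perturbed worst case is
    [g x = f x + mu / 2 * |x|^2] ([worst_case_perturbed]).

    Existence and uniqueness of the minimiser of [g]. The function [f] is a
    supremum of linear functions with uniformly bounded coefficient vectors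
    [A *m y], hence convex and Lipschitz; so [f] and [g] attain their minimum
    on the compact set [X] ([polytope_argmin]). Adding [mu / 2 * |x|^2] makes
    the minimiser unique ([perturbed_minimax_unique]).

    The minimiser [x] of [g] lies in [S] ([minimax_of_perturbed]). For every
    [s] in [S], comparing [g x] with [g s] gives
    [f x - v <= mu / 2 * (|s|^2 - |x|^2) <= mu * M * |x - s|],
    and the infimum over [s] turns the right-hand side into
    [mu * M * dist x S]. The growth hypothesis bounds the left-hand side below
    by [alpha * dist x S]. As [mu * M < alpha], the distance is [0], and then
    the upper bound gives [f x <= v]: the sharp linear growth of [f] beats the
    quadratic term, whose Lipschitz constant on [X] is [mu * M]. *)

(** * Euclidean inner product and norm *)

Definition dot (R : realType) (k : nat) (x y : 'cV[R]_k) : R :=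
  \sum_(i < k) x i 0 * y i 0.

Lemma dotC (R : realType) (k : nat) (x y : 'cV[R]_k) : dot x y = dot y x.
Proof. by apply: eq_bigr => i _; rewrite mulrC. Qed.

Lemma dotDl (R : realType) (k : nat) (x y z : 'cV[R]_k) :
  dot (x + y) z = dot x z + dot y z.
Proof.
by rewrite /dot -big_split; apply: eq_bigr => i _; rewrite mxE mulrDl.
Qed.

Lemma dotZl (R : realType) (k : nat) (c : R) (x z : 'cV[R]_k) :
  dot (c *: x) z = c * dot x z.
Proof. by rewrite /dot mulr_sumr; apply: eq_bigr => i _; rewrite mxE mulrA. Qed.

Lemma dotNl (R : realType) (k : nat) (x z : 'cV[R]_k) :
  dot (- x) z = - dot x z.
Proof. by rewrite -scaleN1r dotZl mulN1r. Qed.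

Lemma dotDr (R : realType) (k : nat) (x y z : 'cV[R]_k) :
  dot z (x + y) = dot z x + dot z y.
Proof. by rewrite dotC dotDl !(dotC z). Qed.

Lemma dotZr (R : realType) (k : nat) (c : R) (x z : 'cV[R]_k) :
  dot z (c *: x) = c * dot z x.
Proof. by rewrite dotC dotZl dotC. Qed.

Lemma dotNr (R : realType) (k : nat) (x z : 'cV[R]_k) :
  dot z (- x) = - dot z x.
Proof. by rewrite dotC dotNl dotC. Qed.

Lemma dot_ge0 (R : realType) (k : nat) (x : 'cV[R]_k) : 0 <= dot x x.
Proof. by apply: sumr_ge0 => i _; rewrite -expr2 sqr_ge0. Qed.

Lemma dot_eq0 (R : realType) (k : nat) (x : 'cV[R]_k) : dot x x = 0 -> x = 0.
Proof.
move=> /eqP; rewrite psumr_eq0; last by move=> i _; rewrite -expr2 sqr_ge0.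
move=> /allP h; apply/colP => i; rewrite mxE.
by have := h i (mem_index_enum i); rewrite mulf_eq0 orbb => /eqP.
Qed.

Lemma enorm_ge0 (R : realType) (k : nat) (x : 'cV[R]_k) : 0 <= enorm x.
Proof. exact: sqrtr_ge0. Qed.

Lemma sqr_enorm (R : realType) (k : nat) (x : 'cV[R]_k) :
  enorm x ^+ 2 = dot x x.
Proof.
rewrite /enorm sqr_sqrtr; last by apply: sumr_ge0 => i _; rewrite sqr_ge0.
by apply: eq_bigr => i _; rewrite expr2.
Qed.

Lemma enorm0_eq0 (R : realType) (k : nat) (x : 'cV[R]_k) : enorm x = 0 -> x = 0.
Proof. by move=> x0; apply: dot_eq0; rewrite -sqr_enorm x0 expr0n. Qed.

(** Cauchy-Schwarz: expand the square of [|y|^2 x - <x,y> y]. *)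
Lemma dot_le_enorm (R : realType) (k : nat) (x y : 'cV[R]_k) :
  dot x y <= enorm x * enorm y.
Proof.
have := enorm_ge0 x; have := enorm_ge0 y.
have [y0|ynz] := eqVneq (dot y y) 0.
  move: y0 => /dot_eq0 -> *; rewrite dotC -(scale0r (0 : 'cV_k)) dotZl mul0r.
  by rewrite mulr_ge0 ?enorm_ge0.
have := dot_ge0 (dot y y *: x - dot x y *: y).
rewrite !(dotDl, dotNl, dotDr, dotNr, dotZl, dotZr) (dotC y x).
have : 0 < dot y y by rewrite lt_neqAle eq_sym ynz dot_ge0.
move: (sqr_enorm x) (sqr_enorm y).
set a := dot x x; set b := dot x y; set c := dot y y.
set p := enorm x; set q := enorm y => pa qc c0 h q0 p0.
have {h} : 0 <= c * (a * c - b ^+ 2) by move: h; congr (_ <= _); ring.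
rewrite pmulr_rge0 // subr_ge0 -pa -qc -exprMn => h.
rewrite (le_trans (ler_norm b))// -ler_sqr ?nnegrE ?mulr_ge0//.
by rewrite real_normK ?num_real.
Qed.

Lemma enormN (R : realType) (k : nat) (x : 'cV[R]_k) : enorm (- x) = enorm x.
Proof. by congr Num.sqrt; apply: eq_bigr => i _; rewrite mxE sqrrN. Qed.

(** The difference of squares is [<s - x, s + x>], and [|s + x| <= 2 M] by the
    parallelogram identity. *)
Lemma sqr_enorm_lipschitz (R : realType) (k : nat) (M : R) (s x : 'cV[R]_k) :
  enorm s <= M -> enorm x <= M ->
  enorm s ^+ 2 - enorm x ^+ 2 <= 2 * M * enorm (x - s).
Proof.
move=> sM xM.
have M0 : 0 <= M := le_trans (enorm_ge0 s) sM.
have sum_le : enorm (s + x) <= 2 * M.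
  rewrite -ler_sqr ?nnegrE ?mulr_ge0 ?enorm_ge0//.
  have := dot_ge0 (s - x).
  rewrite sqr_enorm !(dotDl, dotNl, dotDr, dotNr) (dotC x s).
  have := lerXn2r 2 (enorm_ge0 s) M0 sM.
  have := lerXn2r 2 (enorm_ge0 x) M0 xM.
  rewrite !sqr_enorm exprMn; lra.
have -> : enorm s ^+ 2 - enorm x ^+ 2 = dot (s - x) (s + x).
  by rewrite !sqr_enorm !(dotDl, dotNl, dotDr, dotNr) (dotC x s); ring.
rewrite (le_trans (dot_le_enorm _ _))// mulrC -(enormN (x - s)) opprB.
by rewrite ler_wpM2r ?enorm_ge0.
Qed.

Lemma coord_le_enorm (R : realType) (k : nat) (x : 'cV[R]_k) (i : 'I_k) :
  `|x i 0| <= enorm x.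
Proof.
rewrite -ler_sqr ?nnegrE ?enorm_ge0// sqr_enorm real_normK ?num_real//.
rewrite /dot (bigD1 i)//= -expr2 lerDl; apply: sumr_ge0 => j _.
by rewrite -expr2 sqr_ge0.
Qed.

(** * Polytopes are compact and convex *)

Lemma polytope_midpoint (R : realType) (k : nat) (P : set 'cV[R]_k)
    (x z : 'cV[R]_k) : polytope P -> P x -> P z -> P (2^-1 *: (x + z)).
Proof.
move=> [[p [C [b ->]]] _] /= Px Pz i.
rewrite -scalemxAr mulmxDr !mxE; have := Px i; have := Pz i; rewrite !mxE; lra.
Qed.

Lemma continuous_mulmx_entry (R : realType) (p k : nat) (C : 'M[R]_(p, k)) i :
  continuous (fun x : 'cV[R]_k => (C *m x) i 0).
Proof.
under eq_fun do rewrite mxE.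
apply: continuous_big; first by move=> x; exact: add_continuous.
move=> j _ x.
exact: (cvgMl_tmp (@coord_continuous _ _ _ j 0 x)).
Qed.

Lemma closed_polyhedron (R : realType) (k : nat) (P : set 'cV[R]_k) :
  polyhedron P -> closed P.
Proof.
move=> [p [C [b ->]]].
rewrite (_ : mkset _ = \bigcap_(i in setT)
  ((fun x : 'cV[R]_k => (C *m x) i 0) @^-1` [set r | r <= b i 0])).
  apply: closed_bigI => i _; apply: preimage_closed; last exact: closed_le.
  by move=> x _; exact: continuous_mulmx_entry.
by apply/seteqP; split=> [x Px i _|x Px i]; apply: Px.
Qed.

Lemma trmx_continuous (R : realType) (p k : nat) :
  continuous (trmx : 'M[R]_(p, k) -> 'M[R]_(k, p)).
Proof.
move=> x B [U nU sU]; exists (fun i j => U j i) => [i j|y yU].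
  by have := nU j i; rewrite mxE.
by apply: sU => i j; rewrite mxE; exact: yU.
Qed.

(** A polytope is a closed subset of a cube, and a cube is a product of
    segments. Transposition carries the cube of row vectors, compact by
    Tychonoff, onto the cube of column vectors. *)
Lemma compact_polytope (R : realType) (k : nat) (P : set 'cV[R]_k) :
  polytope P -> compact P.
Proof.
move=> [polP [M PM]].
pose box := [set v : 'rV[R]_k | forall i, `[- M, M]%classic (v ord0 i)].
have cbox : compact box.
  apply: (@rV_compact _ _ (fun=> `[- M, M]%classic)) => _.
  exact: segment_compact.
apply: (@subclosed_compact _ P (trmx @` box)).
- exact: closed_polyhedron.
- apply: continuous_compact cbox; apply: continuous_subspaceT.
  exact: trmx_continuous.
- move=> x Px; exists x^T; last by rewrite trmxK.
  move=> i /=; rewrite mxE in_itv/= -ler_norml.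
  exact: le_trans (coord_le_enorm _ _) (PM _ Px).
Qed.

Lemma polytope_argmin (R : realType) (k : nat) (P : set 'cV[R]_k)
    (f : 'cV[R]_k -> R) :
  polytope P -> P !=set0 -> continuous f -> argmin P f !=set0.
Proof.
move=> polP P0 cf.
have [c cP cmin] := compact_EVT_min P0 (compact_polytope polP)
  (continuous_subspaceT cf).
exists c; split; first by rewrite -inE.
by move=> z Pz; apply: cmin; rewrite inE.
Qed.

Lemma continuous_enorm (R : realType) (k : nat) :
  continuous (@enorm R k).
Proof.
move=> x; apply: (@continuous_comp _ _ _ _ (@Num.sqrt R)); last first.
  exact: sqrt_continuous.
move: x; apply: continuous_big; first by move=> x; exact: add_continuous.
move=> i _ x; apply: (@continuous_comp _ _ _ _ (fun r : R => r ^+ 2)).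
  exact: coord_continuous.
exact: exprn_continuous.
Qed.

(** * Worst-case payoffs *)

Lemma payoffE (R : realType) (m n : nat) (A : 'M[R]_(m, n)) x y :
  payoff A x y = dot x (A *m y).
Proof. by rewrite /payoff -mulmxA mxE; apply: eq_bigr => i _; rewrite mxE. Qed.

(** A uniform bound on the coefficient vectors [A *m y] of the linear functions
    whose supremum is the worst case: it makes that supremum finite, and it is
    its Lipschitz constant. *)
Lemma polytope_mulmx_bounded (R : realType) (m n : nat) (A : 'M[R]_(m, n))
    (Y : set 'cV[R]_n) :
  polytope Y -> exists2 K : R, 0 <= K & forall y, Y y -> enorm (A *m y) <= K.
Proof.
move=> [_ [M YM]].
pose c i := enorm (row i A)^T * M.
exists (Num.sqrt (\sum_i c i ^+ 2)); first exact: sqrtr_ge0.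
move=> y Yy; apply: ler_wsqrtr; apply: ler_sum => i _.
have dE u : (A *m u) i 0 = dot (row i A)^T u.
  by rewrite mxE; apply: eq_bigr => j _; rewrite !mxE.
(* Stated for all vectors of norm at most [M], so as to apply to [- y] too. *)
have bound u : enorm u <= M -> (A *m u) i 0 <= c i.
  move=> uM; rewrite dE (le_trans (dot_le_enorm _ _))//.
  by rewrite ler_wpM2l ?enorm_ge0.
rewrite -[leLHS]real_normK ?num_real// lerXn2r ?nnegrE//.
  by rewrite mulr_ge0 ?enorm_ge0// (le_trans (enorm_ge0 y) (YM _ Yy)).
rewrite ler_norml bound ?YM// andbT lerNl.
have := bound (- y); rewrite mulmxN mxE enormN; apply; exact: YM.
Qed.

Lemma worst_case_le (R : realType) (m n : nat) (Y : set 'cV[R]_n)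
    (u : 'cV[R]_m -> 'cV[R]_n -> R) x c :
  Y !=set0 -> (forall y, Y y -> u x y <= c) -> worst_case Y u x <= c.
Proof.
move=> [y0 Yy0] le_c; apply: ge_sup; first by exists (u x y0), y0.
by move=> _ [y Yy <-]; exact: le_c.
Qed.

Lemma worst_case_ge (R : realType) (m n : nat) (A : 'M[R]_(m, n))
    (Y : set 'cV[R]_n) x y :
  polytope Y -> Y y -> payoff A x y <= worst_case Y (payoff A) x.
Proof.
move=> polY Yy; have [K _ YK] := polytope_mulmx_bounded A polY.
apply: ub_le_sup; last by exists y.
exists (enorm x * K) => _ [z Yz <-]; rewrite payoffE.
rewrite (le_trans (dot_le_enorm _ _))// ler_wpM2l ?enorm_ge0//.
exact: YK.
Qed.

(** The perturbation does not depend on the opponent's strategy, so it comes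
    out of the supremum. *)
Lemma worst_case_perturbed (R : realType) (m n : nat) (A : 'M[R]_(m, n))
    (Y : set 'cV[R]_n) mu x :
  polytope Y -> Y !=set0 ->
  worst_case Y (perturbed_payoff A mu) x =
  worst_case Y (payoff A) x + mu / 2 * enorm x ^+ 2.
Proof.
move=> polY Y0; apply/eqP; rewrite eq_le; apply/andP; split.
  by apply: worst_case_le => // y Yy; rewrite lerD2r; exact: worst_case_ge.
rewrite -lerBrDr; apply: worst_case_le => // y Yy; rewrite lerBrDr.
apply: ub_le_sup; last by exists y.
exists (worst_case Y (payoff A) x + mu / 2 * enorm x ^+ 2) => _ [z Yz <-].
by rewrite lerD2r; exact: worst_case_ge.
Qed.

(** Midpoint convexity: the payoff against each fixed [y] is linear. *)
Lemma worst_case_midpoint (R : realType) (m n : nat) (A : 'M[R]_(m, n))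
    (Y : set 'cV[R]_n) x z :
  polytope Y -> Y !=set0 ->
  worst_case Y (payoff A) (2^-1 *: (x + z)) <=
  (worst_case Y (payoff A) x + worst_case Y (payoff A) z) / 2.
Proof.
move=> polY Y0; apply: worst_case_le => // y Yy.
have := worst_case_ge A x polY Yy.
have := worst_case_ge A z polY Yy.
rewrite !payoffE dotZl dotDl; lra.
Qed.

(** A supremum of functions that share the Lipschitz constant [K] is
    [K]-Lipschitz. *)
Lemma worst_case_continuous (R : realType) (m n : nat) (A : 'M[R]_(m, n))
    (Y : set 'cV[R]_n) :
  polytope Y -> Y !=set0 -> continuous (worst_case Y (payoff A)).
Proof.
move=> polY Y0; have [K K0 YK] := polytope_mulmx_bounded A polY.
have lip x z : worst_case Y (payoff A) x - worst_case Y (payoff A) z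
    <= K * enorm (x - z).
  rewrite lerBlDr; apply: worst_case_le => // y Yy.
  have := worst_case_ge A z polY Yy.
  have := dot_le_enorm (x - z) (A *m y).
  have := ler_wpM2l (enorm_ge0 (x - z)) (YK y Yy).
  rewrite !payoffE dotDl dotNl; lra.
move=> x; apply/(@cvgrPdist_le _ _ _ (nbhs x)) => e e0.
have cv : K * enorm (x - z) @[z --> x] --> (0 : R).
  have -> : 0 = K * enorm (x - x).
    by rewrite subrr /enorm big1 ?sqrtr0 ?mulr0// => i _; rewrite mxE expr0n.
  have sub_cont : {for x, continuous (fun z : 'cV[R]_m => x - z)}.
    exact: continuousB (@cst_continuous _ _ x x) cvg_id.
  exact: cvgMl_tmp (continuous_comp sub_cont (@continuous_enorm _ _ _)).
move/(@cvgrPdist_le _ _ _ (nbhs x)) : cv => /(_ e e0); apply: filterS => z.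
rewrite sub0r normrN; apply: le_trans; apply: le_trans (ler_norm _).
by rewrite ler_norml lip andbT lerNl opprB -(enormN (x - z)) opprB lip.
Qed.

(** * The perturbed game *)

(** By the parallelogram identity, the midpoint of two distinct minimisers
    would beat both by at least [mu / 8] times their squared distance. *)
Lemma perturbed_minimax_unique (R : realType) (m n : nat) (A : 'M[R]_(m, n))
    (X : set 'cV[R]_m) (Y : set 'cV[R]_n) mu x z :
  polytope X -> polytope Y -> Y !=set0 -> 0 < mu ->
  minimax_strategies X Y (perturbed_payoff A mu) x ->
  minimax_strategies X Y (perturbed_payoff A mu) z -> x = z.
Proof.
move=> polX polY Y0 mu0 [Xx xmin] [Xz zmin].
have Xw := polytope_midpoint polX Xx Xz.
have := xmin _ Xw; have := zmin _ Xw.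
rewrite !worst_case_perturbed//.
have := worst_case_midpoint A x z polY Y0.
move=> conv gz gx; apply/eqP; rewrite -subr_eq0; apply/eqP; apply: dot_eq0.
apply/eqP; rewrite eq_le dot_ge0 andbT -(pmulr_rle0 _ mu0).
have par : dot (x - z) (x - z) = 2 * enorm x ^+ 2 + 2 * enorm z ^+ 2
    - 4 * enorm (2^-1 *: (x + z)) ^+ 2.
  rewrite !sqr_enorm !(dotDl, dotNl, dotDr, dotNr, dotZl, dotZr) (dotC z x).
  by field.
rewrite par; lra.
Qed.

Lemma game_valueE (R : realType) (m n : nat) (X : set 'cV[R]_m)
    (Y : set 'cV[R]_n) u s :
  minimax_strategies X Y u s -> game_value X Y u = worst_case Y u s.
Proof.
move=> [Xs smin]; apply/eqP; rewrite eq_le; apply/andP; split.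
  apply: ge_inf; last by exists s.
  by exists (worst_case Y u s) => _ [x Xx <-]; exact: smin.
apply: lb_le_inf; first by exists (worst_case Y u s), s.
by move=> _ [x Xx <-]; exact: smin.
Qed.

Lemma enorm_le_max (R : realType) (k : nat) (P : set 'cV[R]_k) x :
  polytope P -> P x -> enorm x <= max_enorm P.
Proof.
move=> [_ [M PM]] Px; apply: ub_le_sup; last by exists x.
by exists M => _ [z Pz <-]; exact: PM.
Qed.

(** When [c = 0] the extended quotient is infinite and the conclusion reads
    [0 < b]. *)
Lemma mul_lt_of_lt_ediv (R : realType) (a b c : R) :
  0 < b -> 0 <= c -> (a%:E < b%:E / c%:E)%E -> a * c < b.
Proof.
move=> b0; rewrite le_eqVlt => /predU1P[<- _|c0]; first by rewrite mulr0.
by rewrite inver gt_eqF// -EFinM lte_fin ltr_pdivlMr.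
Qed.

(** The slope [alpha] at which the worst case leaves its minimum exceeds the
    Lipschitz constant [mu * max_enorm X] of the perturbation on [X], so leaving
    the minimax set never pays off. *)
Lemma minimax_of_perturbed (R : realType) (m n : nat)
    (X : set 'cV[R]_m) (Y : set 'cV[R]_n) (A : 'M[R]_(m, n)) (alpha mu : R) x :
  polytope X -> polytope Y -> Y !=set0 ->
  minimax_strategies X Y (payoff A) !=set0 ->
  alpha * dist x (minimax_strategies X Y (payoff A))
    <= worst_case Y (payoff A) x - game_value X Y (payoff A) ->
  0 < mu -> mu * max_enorm X < alpha ->
  minimax_strategies X Y (perturbed_payoff A mu) x ->
  minimax_strategies X Y (payoff A) x.
Proof.
set S := minimax_strategies X Y (payoff A).
set f := worst_case Y (payoff A); set v := game_value _ _ _.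
move=> polX polY Y0 S0 growth mu0 mu_lt [Xx xmin].
have vE s : S s -> v = f s by exact: game_valueE.
have M0 : 0 <= max_enorm X.
  by rewrite (le_trans (enorm_ge0 x))// enorm_le_max.
have gap_le s : S s -> f x - v <= mu * max_enorm X * enorm (x - s).
  move=> Ss; have Xs := Ss.1; rewrite (vE _ Ss).
  have := xmin _ Xs; rewrite !worst_case_perturbed// -/f => gap.
  have := sqr_enorm_lipschitz (enorm_le_max polX Xs)
    (enorm_le_max polX Xx).
  move=> /(ler_wpM2l (ltW mu0)); lra.
(* Division by [mu * max_enorm X] moves the bound under the infimum, so the
   case [X = {0}] is set apart. *)
have gap_dist : f x - v <= mu * max_enorm X * dist x S.
  have [p0|pN0] := eqVneq (mu * max_enorm X) 0.
    by have [s Ss] := S0; have := gap_le s Ss; rewrite p0 !mul0r.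
  have p0 : 0 < mu * max_enorm X.
    by rewrite lt_neqAle eq_sym pN0 mulr_ge0// ltW.
  rewrite mulrC -ler_pdivrMr//; apply: lb_le_inf.
    by have [s Ss] := S0; exists (enorm (x - s)), s.
  by move=> _ [s Ss <-]; rewrite ler_pdivrMr// mulrC; exact: gap_le.
have dist_ge0 : 0 <= dist x S.
  apply: lb_le_inf; first by have [s Ss] := S0; exists (enorm (x - s)), s.
  by move=> _ [s _ <-]; exact: enorm_ge0.
have dist0 : dist x S = 0.
  apply/eqP; rewrite eq_le dist_ge0 andbT.
  have := le_trans growth gap_dist.
  rewrite -subr_le0 -mulrBl pmulr_rle0// subr_gt0//.
split=> // z Xz; have [s Ss] := S0.
apply: le_trans (Ss.2 z Xz); rewrite -/f -(vE s Ss) -subr_le0.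
by rewrite (le_trans gap_dist)// dist0 mulr0.
Qed.

Unset Implicit Arguments.

(* The upper bound on mu is an extended real: when X = {0} the quotient       *)
(* alpha / 0 is +oo, so every mu > 0 is then allowed.                         *)
Theorem corollary3p2 (R : realType) (m n : nat)
    (X : set 'cV[R]_m) (Y : set 'cV[R]_n) (A : 'M[R]_(m, n)) (alpha : R)
    (X_polytope : polytope X) (X_nonempty : X !=set0)
    (Y_polytope : polytope Y) (Y_nonempty : Y !=set0)
    (alpha_gt0 : 0 < alpha)
    (growth : forall x, X x ->
       worst_case Y (payoff A) x - game_value X Y (payoff A)
         >= alpha * dist x (minimax_strategies X Y (payoff A)))
    (mu : R) (mu_gt0 : 0 < mu)
    (mu_lt : (mu%:E < alpha%:E / (max_enorm X)%:E)%E) :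
  exists x_mu : 'cV[R]_m,
    minimax_strategies X Y (perturbed_payoff A mu) = [set x_mu] /\
    minimax_strategies X Y (payoff A) x_mu.
Proof.
have wc_cont := @worst_case_continuous _ _ _ A _ Y_polytope Y_nonempty.
have S0 : minimax_strategies X Y (payoff A) !=set0 by exact: polytope_argmin.
have [x xmin] : minimax_strategies X Y (perturbed_payoff A mu) !=set0.
  apply: polytope_argmin => //.
  rewrite (funext (fun x => worst_case_perturbed A mu x Y_polytope Y_nonempty)).
  move=> x; apply: continuousD; first exact: wc_cont.
  exact: cvgMl_tmp (continuous_comp (@continuous_enorm _ _ x)
    (@exprn_continuous _ 2 _)).
exists x; split.
  apply/seteqP; split=> [z zmin|_ ->//].
  exact: perturbed_minimax_unique zmin xmin.
have Xx := xmin.1.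
apply: (@minimax_of_perturbed _ _ _ _ _ _ alpha mu) => //; first exact: growth.
apply: mul_lt_of_lt_ediv mu_lt => //.
by rewrite (le_trans (enorm_ge0 x))// enorm_le_max.
Qed.
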